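(* Let $X$ be a centered infinitely divisible random vector in $\mathbb{R}^d$ with finite second moment. For every $a\ge0$ and every $t\in\mathbb{R}^d$, $$C_X(at)=a\,C_X(t).$$
   Context: $X$ is a centered infinitely divisible random vector in $\mathbb{R}^d$ with finite second moment and covariance matrix $\Sigma$; $K_X(t):=\log\mathbb{E}e^{\langle t,X\rangle}$ (value $+\infty$ allowed) and $V_X(t):=t^\top\Sigma t$. Directional (radial) pole: if $V_X(t)>0$, $C_X(t)\in[0,\infty]$ is the infimum of all $c\in[0,\infty)$ such that $$K_X(st)\le\frac{V_X(t)s^2}{2(1-cs)}\qquad\text{for all }0\le s<1/c,$$ with $1/0=\infty$ and $\inf\emptyset=\infty$. If $V_X(t)=0$, $C_X(t):=0$. Convention: $0\cdot\infty=0$. *)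

(* Defs.v *)
From HB Require Import structures.
From mathcomp Require Import all_boot all_order all_algebra.
From mathcomp Require Import all_classical all_reals all_analysis.

Set Implicit Arguments.
Unset Strict Implicit.
Unset Printing Implicit Defensive.

Import Order.TTheory GRing.Theory Num.Theory.
Import numFieldNormedType.Exports.

Local Open Scope classical_set_scope.
Local Open Scope ring_scope.

(* R^n with its Borel sigma-algebra, generated by the open sets. *)
Notation borel_rV R n := (g_sigma_algebraType (@open 'rV[R]_n)).

Definition dotp (R : realType) (n : nat) (u v : 'rV[R]_n) : R :=
  \sum_(i < n) u 0 i * v 0 i.

Definition coordinate (R : realType) (n : nat) (T : Type)
  (X : T -> borel_rV R n) (i : 'I_n) : T -> R :=
  fun w => (X w : 'rV[R]_n) 0 i.

(* Two random elements, possibly on different probability spaces, agree in law.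
   Only measurable events are compared, since a measure takes junk values on
   other sets. *)
Definition same_law (R : realType) d1 (T1 : measurableType d1)
    d2 (T2 : measurableType d2) d' (S : measurableType d')
    (P1 : probability T1 R) (P2 : probability T2 R)
    (X1 : T1 -> S) (X2 : T2 -> S) : Prop :=
  forall A : set S, measurable A -> P1 (X1 @^-1` A) = P2 (X2 @^-1` A).

(* The product rule over the whole finite family implies the one over every
   subfamily: take A i = setT for the omitted indices. *)
Definition mutually_independent (R : realType) d (T : measurableType d)
    d' (S : measurableType d') (P : probability T R) (n : nat)
    (Y : 'I_n -> {RV P >-> S}) : Prop :=
  forall A : 'I_n -> set S, (forall i, measurable (A i)) ->
    P (\bigcap_(i in [set: 'I_n]) (Y i @^-1` A i)) =
    (\prod_(i < n) P (Y i @^-1` A i))%E.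

Definition infinitely_divisible (R : realType) (n : nat)
    d (T : measurableType d) (P : probability T R)
    (X : {RV P >-> borel_rV R n}) : Prop :=
  forall m : nat, (0 < m)%N ->
    exists (d' : measure_display) (T' : measurableType d')
      (Q : probability T' R) (Y : 'I_m -> {RV Q >-> borel_rV R n}),
      [/\ mutually_independent Y,
          forall i j : 'I_m, same_law Q Q (Y i) (Y j) &
          same_law P Q X
            (fun w => \sum_(k < m) (Y k w : 'rV[R]_n) : borel_rV R n)].

Section RandomVector.
Context (R : realType) (n : nat) (d : measure_display) (T : measurableType d)
  (P : probability T R) (X : {RV P >-> borel_rV R n}).

Definition finite_second_moment : Prop :=
  ('E_P[fun w => dotp (X w) (X w)] < +oo)%E.

Definition centered : Prop :=
  forall i : 'I_n, ('E_P[coordinate X i] = 0)%E.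

(* `fine` loses nothing when X has finite second moment. *)
Definition covariance_matrix : 'M[R]_n :=
  \matrix_(i < n, j < n) fine (covariance P (coordinate X i) (coordinate X j)).

Definition V_ (t : 'rV[R]_n) : R := (t *m covariance_matrix *m t^T) 0 0.

Definition K_ (t : 'rV[R]_n) : \bar R :=
  lne 'E_P[fun w => expR (dotp t (X w))]%E.

(* The inverse of 0 in \bar R is +oo, as is the infimum of the empty set. *)
Definition C_ (t : 'rV[R]_n) : \bar R :=
  if 0 < V_ t then
    ereal_inf [set c%:E | c in
      [set c : R | 0 <= c /\
        forall s : R, 0 <= s -> (s%:E < (c%:E)^-1)%E ->
          (K_ (s *: t) <= (V_ t * s ^+ 2 / (2 * (1 - c * s)))%:E)%E]]
  else 0%E.

End RandomVector.

(* Main.v *)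
(* Substituting s a for s shows that c is admissible for t only if a c is
   admissible for a t, so C(a t) <= a C(t) for a > 0. The reverse inequality is
   the same bound for the factor a^-1 at the vector a t. *)
Require Import Defs.
From mathcomp Require Import all_boot all_order all_algebra.
From mathcomp Require Import all_classical all_reals all_analysis.
From mathcomp Require Import ring.

Import Order.TTheory GRing.Theory Num.Theory.
Import numFieldNormedType.Exports.

Local Open Scope ring_scope.

(** This turns the range of [s] in [C_] into a real inequality; at [c = 0] the inverse is [+oo], so
    both sides hold for every [s]. *)
Lemma lte_EFin_inver (R : realType) (c s : R) : 0 <= c ->
  (s%:E < (c%:E)^-1)%E = (c * s < 1).
Proof.
rewrite le_eqVlt => /predU1P[<-|c0].
  by rewrite inver eqxx ltry mul0r ltr01.
by rewrite inver gt_eqF// lte_fin -[c^-1]mulr1 ltr_pdivlMl.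
Qed.

Section PoleScaling.
Context (R : realType) (n : nat) (d : measure_display) (T : measurableType d)
  (P : probability T R) (X : {RV P >-> borel_rV R n}).

Lemma V_scale (a : R) (t : 'rV[R]_n) : V_ X (a *: t) = a ^+ 2 * V_ X t.
Proof.
by rewrite /V_ linearZ/= -!scalemxAl -scalemxAr !mxE mulrA -expr2.
Qed.

Lemma C_scale_le (a : R) (t : 'rV[R]_n) : 0 < a ->
  (C_ X (a *: t) <= a%:E * C_ X t)%E.
Proof.
move=> a0; rewrite {2}/C_; case: ifPn => [Vt|Vt]; last first.
  (* As [a ^+ 2 > 0], the variance along [a *: t] is not positive either, so both poles are 0. *)
  by rewrite mule0 /C_ V_scale pmulr_rgt0 ?exprn_gt0// (negbTE Vt).
(* Moving [a] to the left isolates the infimum, so it suffices to compare with each admissible [c];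
   this also covers an empty set. *)
rewrite -lee_pdivrMl//; apply: le_ereal_inf_tmp => _ [c [c0 Kc] <-].
rewrite lee_pdivrMl// /C_ V_scale pmulr_rgt0 ?exprn_gt0// Vt.
apply: ereal_inf_lbound; exists (a * c) => //; split=> [|s s0].
  by rewrite mulr_ge0// ltW.
rewrite lte_EFin_inver ?mulr_ge0 ?(ltW a0)// => acs.
have -> : a ^+ 2 * V_ X t * s ^+ 2 / (2 * (1 - a * c * s)) =
          V_ X t * (s * a) ^+ 2 / (2 * (1 - c * (s * a))).
  by congr (_ / (2 * (1 - _))); ring.
rewrite scalerA; apply: Kc; first by rewrite mulr_ge0// ltW.
by rewrite lte_EFin_inver// (mulrC s) mulrA (mulrC c).
Qed.

End PoleScaling.

(* In \bar R, 0 * +oo = 0. *)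
Theorem proposition2p6 (R : realType) (n : nat) (d : measure_display)
    (T : measurableType d) (P : probability T R)
    (X : {RV P >-> borel_rV R n})
    (X_infdiv : infinitely_divisible X)
    (X_moment2 : finite_second_moment X)
    (X_centered : centered X) :
  forall (a : R) (t : 'rV[R]_n), 0 <= a ->
    C_ X (a *: t) = (a%:E * C_ X t)%E.
Proof.
move=> a t; rewrite le_eqVlt => /predU1P[<-|a0].
  (* For [a = 0] the variance vanishes, which selects the default value 0 of [C_]. *)
  by rewrite mul0e /C_ V_scale expr0n mul0r ltxx.
apply/eqP; rewrite eq_le C_scale_le//= -lee_pdivlMl//.
by rewrite -{1}[t](scalerK (lt0r_neq0 a0)) C_scale_le// invr_gt0.
Qed.
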